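(* Let $\{S_{\mathbf{x}}(f)\}$ be temporal spectral densities on $\Omega$ indexed by spatial locations $\mathbf{x}\in\mathbb{R}^d$, let $\mathbf{u}\in\mathbb{R}^d$ be a fixed vector, let $C_f(\mathbf{x},\mathbf{x}')$ be a real-valued correlation function (in $(\mathbf{x},\mathbf{x}')$, for each $f\in\Omega$), let $g(f)$ be an odd real-valued function on $\Omega$, and let $K$ be the function $$K((\mathbf{x},t),(\mathbf{x}',t'))=\int_\Omega e^{\,i2\pi f(t-t')+i g(f)\,\mathbf{u}^T(\mathbf{x}-\mathbf{x}')}\,\sqrt{S_{\mathbf{x}}(f)\,S_{\mathbf{x}'}(f)}\;C_f(\mathbf{x},\mathbf{x}')\,\mathrm{d}f .$$ If $\lambda(\mathbf{x},t)\ge 0$ everywhere, then the function $$\tilde K((\mathbf{x},t),(\mathbf{x}',t')):=\lambda(\mathbf{x},t)\,\lambda(\mathbf{x}',t')\,K((\mathbf{x},t),(\mathbf{x}',t'))+\eta^2\,\mathbf{1}_{\{(\mathbf{x},t)=(\mathbf{x}',t')\}}$$ is also a valid covariance function.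
   Context: Here $\Omega=[-\tfrac{1}{2\Delta t},\tfrac{1}{2\Delta t})$ for discrete-time data with sampling interval $\Delta t>0$ (times $t,t'\in\Delta t\,\mathbb{Z}$), or $\Omega=\mathbb{R}$ for continuous-time data (times $t,t'\in\mathbb{R}$). The function $\lambda$ is a real-valued function of space and time, $\eta$ is a real constant, and $\mathbf{1}_{\{\cdot\}}$ denotes the indicator function. A temporal spectral density on $\Omega$ is a nonnegative, integrable function $S:\Omega\to[0,\infty)$ that is symmetric about zero, $S(-f)=S(f)$. A real-valued correlation function is a symmetric function $C:\mathbb{R}^d\times\mathbb{R}^d\to\mathbb{R}$ with $C(\mathbf{x},\mathbf{x})=1$ for all $\mathbf{x}$ that is positive semidefinite: $\sum_{j,k=1}^n a_j a_k C(\mathbf{x}_j,\mathbf{x}_k)\ge 0$ for all $n$, all $\mathbf{x}_1,\dots,\mathbf{x}_n\in\mathbb{R}^d$ and all $a_1,\dots,a_n\in\mathbb{R}$. Oddness of $g$ means $g(-f)=-g(f)$. A valid covariance function for a real-valued process is a real-valued symmetric function of pairs of space-time points that is positive semidefinite: $\sum_{j,k=1}^n a_j a_k \tilde K((\mathbf{x}_j,t_j),(\mathbf{x}_k,t_k))\ge 0$ for all $n$, all space-time points $(\mathbf{x}_j,t_j)$ and all $a_j\in\mathbb{R}$. The word ''also'' refers to the paper's preceding theorem, which asserts that $K$ itself is a valid covariance function under the stated hypotheses.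
   Formalization: The formal theorem also assumes that C_f is even in frequency, C_{-f}(x,x') = C_f(x,x'), without which K need not be real-valued, and that g(f) and C_f(x,x') are measurable in f so that the integral defining K makes sense. *)

(* Defs.v *)
From HB Require Import structures.
From mathcomp Require Import all_boot all_order all_algebra.
From mathcomp Require Import complex.
From mathcomp Require Import all_classical all_reals all_analysis.
Set Implicit Arguments.
Unset Strict Implicit.
Unset Printing Implicit Defensive.
Import Order.TTheory GRing.Theory Num.Theory.
Import numFieldNormedType.Exports.
Local Open Scope classical_set_scope.
Local Open Scope ring_scope.
Local Open Scope complex_scope.

Inductive sampling (R : realType) : Type :=
  | Continuous_time
  | Discrete_time of {posnum R}.
Arguments Continuous_time {R}.

Definition times (R : realType) (s : sampling R) : set R :=
  match s with
  | Continuous_time => setT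
  | Discrete_time dt => [set t | exists k : int, t = k%:~R * dt%:num]
  end.

Definition frequencies (R : realType) (s : sampling R) : set R :=
  match s with
  | Continuous_time => setT
  | Discrete_time dt => `[- (2 * dt%:num)^-1, (2 * dt%:num)^-1[
  end.

Definition spacetime (R : realType) (d : nat) (s : sampling R) :
    set ('cV[R]_d * R) :=
  [set p | times s p.2].

(* In discrete time Omega is half-open: symmetry, oddness and evenness on Omega
   are required at f only when - f also lies in Omega, so they say nothing at
   the left endpoint. *)
Definition symmetric_on (R : realType) (V : Type) (Omega : set R)
    (h : R -> V) : Prop :=
  forall f, Omega f -> Omega (- f) -> h (- f) = h f.

Definition odd_on (R : realType) (Omega : set R) (g : R -> R) : Prop :=
  forall f, Omega f -> Omega (- f) -> g (- f) = - g f.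

Definition spectral_density (R : realType) (Omega : set R) (S : R -> R) : Prop :=
  [/\ forall f, Omega f -> 0 <= S f,
      (@lebesgue_measure R).-integrable Omega (EFin \o S)
    & symmetric_on Omega S].

Definition correlation_function (R : realType) (X : Type) (C : X -> X -> R) :
    Prop :=
  [/\ forall x x', C x x' = C x' x,
      forall x, C x x = 1
    & forall (n : nat) (x : 'I_n -> X) (a : 'I_n -> R),
        0 <= \sum_(j < n) \sum_(k < n) a j * a k * C (x j) (x k)].

(* Kernels are R[i]-valued because K is given by a complex integral; being
   real-valued is therefore part of being a covariance function. *)
Definition covariance_function (R : realType) (X : Type) (D : set X)
    (K : X -> X -> R[i]) : Prop :=
  [/\ forall p q, D p -> D q -> K p q \is Num.real,
      forall p q, D p -> D q -> K p q = K q p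
    & forall (n : nat) (p : 'I_n -> X) (a : 'I_n -> R),
        (forall j, D (p j)) ->
        0 <= \sum_(j < n) \sum_(k < n) (a j * a k)%:C * K (p j) (p k)].

Definition expi (R : realType) (theta : R) : R[i] := cos theta +i* sin theta.

Definition Cintegral (R : realType) (D : set R) (h : R -> R[i]) : R[i] :=
  (\int[@lebesgue_measure R]_(f in D) complex.Re (h f))
  +i* (\int[@lebesgue_measure R]_(f in D) complex.Im (h f)).

Definition dotv (R : realType) (d : nat) (u v : 'cV[R]_d) : R :=
  (u^T *m v) 0 0.

Definition K (R : realType) (d : nat) (Omega : set R)
    (S : 'cV[R]_d -> R -> R) (u : 'cV[R]_d)
    (C : R -> 'cV[R]_d -> 'cV[R]_d -> R) (g : R -> R)
    (p q : 'cV[R]_d * R) : R[i] :=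
  Cintegral Omega (fun f =>
    expi (2 * pi * f * (p.2 - q.2) + g f * dotv u (p.1 - q.1))
    * (Num.sqrt (S p.1 f * S q.1 f) * C f p.1 q.1)%:C).

Definition Ktilde (R : realType) (d : nat) (Omega : set R)
    (S : 'cV[R]_d -> R -> R) (u : 'cV[R]_d)
    (C : R -> 'cV[R]_d -> 'cV[R]_d -> R) (g : R -> R)
    (lambda : 'cV[R]_d -> R -> R) (eta : R)
    (p q : 'cV[R]_d * R) : R[i] :=
  (lambda p.1 p.2 * lambda q.1 q.2)%:C * K Omega S u C g p q
  + (eta ^+ 2)%:C * (p == q)%:R.

(* Main.v *)
(** Writing phi_p(f) = 2 pi f t + g(f) u^T x for p = (x, t), the integrand of K
    is exp(i (phi_p - phi_q)) times a real symmetric amplitude. Its imaginary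
    part is odd in f, so it integrates to zero and K is real. By the addition
    formula for cos and the factorization of sqrt (S_x S_x'), the real part is,
    for each f, a sum of two rescalings of C_f, hence positive semidefinite, and
    integration preserves this. Multiplication by lambda(p) lambda(q) rescales
    the weights, and the quadratic form of the nugget is a sum of squares
    indexed by the distinct points. *)
Require Import Defs.
From mathcomp Require Import all_boot all_order all_algebra.
From mathcomp Require Import complex.
From mathcomp Require Import all_classical all_reals all_analysis.
From mathcomp Require Import measurable_realfun ring lra.
Import Order.TTheory GRing.Theory Num.Theory.
Import numFieldNormedType.Exports.
Local Open Scope classical_set_scope.
Local Open Scope ring_scope.

(** * Integrals of finite sums and of odd functions *)

Lemma Rintegral_sum (d : measure_display) (T : measurableType d)
    (R : realType) (mu : {measure set T -> \bar R}) (D : set T) (I : Type)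
    (r : seq I) (h : I -> T -> R) :
  measurable D -> (forall i, mu.-integrable D (EFin \o h i)) ->
  \int[mu]_(x in D) (\sum_(i <- r) h i x) =
  \sum_(i <- r) \int[mu]_(x in D) h i x.
Proof.
move=> mD ih; elim: r => [|i r IHr].
  under eq_Rintegral do rewrite big_nil.
  by rewrite big_nil Rintegral_cst// mul0r.
under eq_Rintegral do rewrite big_cons.
rewrite big_cons RintegralD ?IHr//.
have -> : EFin \o (fun x => \sum_(j <- r) h j x) =
          (fun x => \sum_(j <- r) (EFin \o h j) x)%E.
  by apply/funext => x /=; rewrite sumEFin.
exact: integrable_sum.
Qed.

(** Lebesgue measure is invariant under reflection, so the integral equals its own opposite.
    Extending [h] by zero outside [D] turns it into an odd function on the whole line, where the
    reflection can be applied. *)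
Lemma Rintegral_odd {R : realType} (D : set R) (h : R -> R) :
  measurable D -> (forall f, D f -> D (- f)) ->
  (@lebesgue_measure R).-integrable D (EFin \o h) ->
  odd_on D h -> \int[@lebesgue_measure R]_(f in D) h f = 0.
Proof.
move=> mD DN ih oh.
have DNE f : (- f \in D) = (f \in D).
  by apply/idP/idP => /set_mem /DN; rewrite ?opprK => /mem_set.
pose h0 := h \_ D.
have h0N f : h0 (- f) = - h0 f.
  rewrite /h0 !patchE DNE; case: ifPn => [fD|_]; last by rewrite oppr0.
  by apply: oh; [exact: set_mem|apply: set_mem; rewrite DNE].
have ih0 : (@lebesgue_measure R).-integrable setT (EFin \o h0).
  rewrite -restrict_EFin.
  (* [lebesgue_measure] lives on [measurableTypeR R], which is not the
     structure inferred by default on [R]. *)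
  exact: (@integrable_mkcond _ (measurableTypeR R) R _ D (EFin \o h) mD).1.
have mh0 := measurable_int _ ih0.
(* Side condition of the change of variables [f] to [- f] below. *)
have ih0N : (@lebesgue_measure R).-integrable setT ((EFin \o h0) \o -%R).
  have -> : (EFin \o h0) \o -%R = -%E \o (EFin \o h0).
    by apply/funext => f /=; rewrite h0N EFinN.
  exact: integrableN.
rewrite Rintegral_mkcond -/h0.
have : \int[@lebesgue_measure R]_f h0 f = - \int[@lebesgue_measure R]_f h0 f.
  rewrite -[RHS]mulN1r -RintegralZl// /Rintegral; congr fine.
  transitivity (\int[pushforward (@lebesgue_measure R)
      (-%R : _ -> measurableTypeR R)]_f (EFin \o h0) f)%E.
    by apply: eq_measure_integral => A mA _; exact/esym/lebesgue_measureN.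
  rewrite (@integral_pushforward _ _ (measurableTypeR R) (measurableTypeR R))//.
  rewrite preimage_setT; apply: eq_integral => f _ /=.
  by rewrite h0N mulN1r.
lra.
Qed.

(** * Quadratic forms of the nugget and of correlation functions *)

(** The points may repeat, so off-diagonal terms can survive. Grouping the indices by their common
    value [v] gives the square of the total weight carried by [v]. *)
Lemma sum_eq_ge0 {R : realDomainType} {X : eqType} (n : nat) (p : 'I_n -> X)
    (a : 'I_n -> R) :
  0 <= \sum_(j < n) \sum_(k < n) a j * a k * (p j == p k)%:R.
Proof.
pose r := undup [seq p j | j <- enum 'I_n].
have rp j : p j \in r by rewrite mem_undup map_f// mem_enum.
have -> : \sum_(j < n) \sum_(k < n) a j * a k * (p j == p k)%:R =
          \sum_(v <- r) (\sum_(j < n) a j * (p j == v)%:R) ^+ 2.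
  transitivity (\sum_(v <- r) \sum_(j < n) \sum_(k < n)
      (a j * (p j == v)%:R) * (a k * (p k == v)%:R)); last first.
    apply: eq_bigr => v _; rewrite expr2 mulr_suml.
    by apply: eq_bigr => j _; rewrite mulr_sumr.
  rewrite [RHS]exchange_big/=; apply: eq_bigr => j _.
  rewrite [RHS]exchange_big/=; apply: eq_bigr => k _.
  (* Only [v = p j] contributes, and it occurs exactly once in [r]. *)
  rewrite (bigD1_seq (p j)) ?undup_uniq//= eqxx eq_sym mulr1 mulrA.
  rewrite big1 ?addr0// => v vj.
  by rewrite [p j == v]eq_sym (negbTE vj) mulr0 mul0r.
by apply: sumr_ge0 => v _; exact: sqr_ge0.
Qed.

(** On the two points [x], [x'], the weights (1, 1) and (1, -1) give [0 <= 2 + 2 * C x x'] and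
    [0 <= 2 - 2 * C x x']. *)
Lemma correlation_function_le1 {R : realType} {X : Type} (C : X -> X -> R) :
  correlation_function C -> forall x x', `|C x x'| <= 1.
Proof.
move=> [Csym C1 Cpsd] x x'.
pose y (i : 'I_2) := if i == ord0 then x else x'.
have /= := Cpsd 2 y (fun=> 1).
have /= := Cpsd 2 y (fun i => if i == ord0 then 1 else -1).
rewrite !big_ord_recl !big_ord0 /y/= !C1 (Csym x' x) ler_norml => ? ?.
by apply/andP; split; lra.
Qed.

(** * Phase, amplitude and integrability of the integrand *)

Definition wave_phase {R : realType} {d : nat} (u : 'cV[R]_d) (g : R -> R)
    (p : 'cV[R]_d * R) (f : R) : R :=
  2 * pi * f * p.2 + g f * dotv u p.1.

Definition cross_amplitude {R : realType} {d : nat} (S : 'cV[R]_d -> R -> R)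
    (C : R -> 'cV[R]_d -> 'cV[R]_d -> R) (p q : 'cV[R]_d * R) (f : R) : R :=
  Num.sqrt (S p.1 f * S q.1 f) * C f p.1 q.1.

Lemma KE {R : realType} {d : nat} (Omega : set R) (S : 'cV[R]_d -> R -> R)
    (u : 'cV[R]_d) (C : R -> 'cV[R]_d -> 'cV[R]_d -> R) (g : R -> R)
    (p q : 'cV[R]_d * R) :
  K Omega S u C g p q =
  Complex
    (\int[@lebesgue_measure R]_(f in Omega)
      (cos (wave_phase u g p f - wave_phase u g q f) *
       cross_amplitude S C p q f))
    (\int[@lebesgue_measure R]_(f in Omega)
      (sin (wave_phase u g p f - wave_phase u g q f) *
       cross_amplitude S C p q f)).
Proof.
have E f : 2 * pi * f * (p.2 - q.2) + g f * dotv u (p.1 - q.1) =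
    wave_phase u g p f - wave_phase u g q f.
  by rewrite /wave_phase /dotv mulmxBr !mxE; ring.
by rewrite /K /Cintegral; congr Complex; apply: eq_Rintegral => f _;
  rewrite E /expi /cross_amplitude/= mulr0 ?subr0 ?add0r.
Qed.

Lemma measurable_frequencies {R : realType} (s : sampling R) :
  measurable (frequencies s).
Proof. by case: s => [|dt] /=; [exact: measurableT|exact: measurable_itv]. Qed.

Lemma measurable_wave_phase {R : realType} {d : nat} (Omega : set R)
    (u : 'cV[R]_d) (g : R -> R) (p : 'cV[R]_d * R) :
  measurable_fun Omega g -> measurable_fun Omega (wave_phase u g p).
Proof.
by move=> mg; apply: measurable_funD; apply: measurable_funM.
Qed.

(** The function is dominated by [S p.1 + S q.1], since [b] and [C] are bounded by 1 and a geometric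
    mean is at most the sum. The factor [b] will be the cosine or sine of a phase difference. *)
Lemma integrable_bounded_amplitude {R : realType} {d : nat} (Omega : set R)
    (S : 'cV[R]_d -> R -> R) (C : R -> 'cV[R]_d -> 'cV[R]_d -> R)
    (p q : 'cV[R]_d * R) (b : R -> R) :
  measurable Omega ->
  (forall x, spectral_density Omega (S x)) ->
  (forall f, Omega f -> correlation_function (C f)) ->
  (forall x x', measurable_fun Omega (fun f => C f x x')) ->
  measurable_fun Omega b -> (forall f, `|b f| <= 1) ->
  (@lebesgue_measure R).-integrable Omega
    (EFin \o (fun f => b f * cross_amplitude S C p q f)).
Proof.
move=> mO HS HC mC mb b1.
have mS x : measurable_fun Omega (S x).
  by case: (HS x) => _ iS _; apply/measurable_EFinP; exact: measurable_int iS.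
have iSD : (@lebesgue_measure R).-integrable Omega
    (EFin \o (fun f => S p.1 f + S q.1 f)).
  have [_ ip _] := HS p.1; have [_ iq _] := HS q.1.
  exact: (@integrableD _ (measurableTypeR R) R _ Omega mO _ _ ip iq).
apply: le_integrable iSD => //.
  apply/measurable_EFinP; apply: measurable_funM; first exact: mb.
  apply: measurable_funM; last exact: mC.
  apply: measurableT_comp; last by apply: measurable_funM; exact: mS.
  by apply: continuous_measurable_fun; exact: sqrt_continuous.
move=> f Of /=; rewrite lee_fin.
have [Sp _ _] := HS p.1; have [Sq _ _] := HS q.1.
have {}Sp := Sp f Of; have {}Sq := Sq f Of.
rewrite (ger0_norm (addr_ge0 Sp Sq)) normrM.
apply: (@le_trans _ _ `|cross_amplitude S C p q f|).
  by rewrite ler_piMl.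
rewrite /cross_amplitude normrM ger0_norm ?sqrtr_ge0//.
apply: (@le_trans _ _ (Num.sqrt (S p.1 f * S q.1 f))).
  by rewrite ler_piMr ?sqrtr_ge0// correlation_function_le1//; exact: HC.
(* Writing the sum as the root of its square leaves a polynomial inequality. *)
rewrite -[leRHS]ger0_norm ?addr_ge0// -sqrtr_sqr ler_wsqrtr//.
rewrite sqrrD; nra.
Qed.

Lemma Rintegral_frequencies_odd {R : realType} (s : sampling R) (h : R -> R) :
  (@lebesgue_measure R).-integrable (frequencies s) (EFin \o h) ->
  odd_on (frequencies s) h ->
  \int[@lebesgue_measure R]_(f in frequencies s) h f = 0.
Proof.
case: s => [|dt] /= ih oh; first exact: Rintegral_odd.
set a := (2 * dt%:num)^-1 in ih oh *.
(* Dropping the null left endpoint makes the domain symmetric. *)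
have sub : `]- a, a[ `<=` `[- a, a[.
  by apply: subset_itvr; rewrite bnd_simp.
have ih' : (@lebesgue_measure R).-integrable `]- a, a[ (EFin \o h).
  by apply: integrableS ih => //; exact: measurable_itv.
rewrite -Rintegral_itv_obnd_cbnd//; apply: Rintegral_odd => //.
- by move=> f /=; rewrite !in_itv/= => /andP[? ?]; rewrite ltrN2 ltrNl; apply/andP.
- by move=> f fI fNI; apply: oh; exact: sub.
Qed.

(** * Positive semidefiniteness at a fixed frequency *)

(** The square root of the product factors, and each factor is absorbed into the weight of its
    point. *)
Lemma cross_amplitude_psd {R : realType} {d : nat} (S : 'cV[R]_d -> R -> R)
    (C : R -> 'cV[R]_d -> 'cV[R]_d -> R) (f : R) (n : nat)
    (p : 'I_n -> 'cV[R]_d * R) (a : 'I_n -> R) :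
  (forall x, 0 <= S x f) -> correlation_function (C f) ->
  0 <= \sum_(j < n) \sum_(k < n) a j * a k * cross_amplitude S C (p j) (p k) f.
Proof.
move=> S0 [_ _ Cpsd].
have := Cpsd n (fun j => (p j).1) (fun j => a j * Num.sqrt (S (p j).1 f)).
congr (0 <= _); apply: eq_bigr => j _; apply: eq_bigr => k _.
by rewrite /cross_amplitude sqrtrM//; ring.
Qed.

(** By the addition formula, the form is the sum of two amplitude forms, with weights
    [a j * cos (theta j)] and [a j * sin (theta j)]. *)
Lemma cos_cross_amplitude_psd {R : realType} {d : nat}
    (S : 'cV[R]_d -> R -> R) (C : R -> 'cV[R]_d -> 'cV[R]_d -> R) (f : R)
    (n : nat) (p : 'I_n -> 'cV[R]_d * R) (a theta : 'I_n -> R) :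
  (forall x, 0 <= S x f) -> correlation_function (C f) ->
  0 <= \sum_(j < n) \sum_(k < n)
         a j * a k * (cos (theta j - theta k) * cross_amplitude S C (p j) (p k) f).
Proof.
move=> S0 HC.
have := addr_ge0
  (cross_amplitude_psd S C f n p (fun j => a j * cos (theta j)) S0 HC)
  (cross_amplitude_psd S C f n p (fun j => a j * sin (theta j)) S0 HC).
congr (0 <= _); rewrite -big_split; apply: eq_bigr => j _ /=.
rewrite -big_split; apply: eq_bigr => k _ /=.
by rewrite cosB; ring.
Qed.

(** * The kernel as a real integral *)

Definition real_K {R : realType} {d : nat} (Omega : set R)
    (S : 'cV[R]_d -> R -> R) (u : 'cV[R]_d)
    (C : R -> 'cV[R]_d -> 'cV[R]_d -> R) (g : R -> R)
    (p q : 'cV[R]_d * R) : R :=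
  \int[@lebesgue_measure R]_(f in Omega)
    (cos (wave_phase u g p f - wave_phase u g q f) * cross_amplitude S C p q f).

Lemma K_real {R : realType} {d : nat} (s : sampling R)
    (S : 'cV[R]_d -> R -> R) (u : 'cV[R]_d)
    (C : R -> 'cV[R]_d -> 'cV[R]_d -> R) (g : R -> R) (p q : 'cV[R]_d * R) :
  (forall x, spectral_density (frequencies s) (S x)) ->
  (forall f, frequencies s f -> correlation_function (C f)) ->
  (forall x x', measurable_fun (frequencies s) (fun f => C f x x')) ->
  (forall x x', symmetric_on (frequencies s) (fun f => C f x x')) ->
  measurable_fun (frequencies s) g -> odd_on (frequencies s) g ->
  K (frequencies s) S u C g p q = (real_K (frequencies s) S u C g p q)%:C%C.
Proof.
move=> HS HC mC eC mg og; rewrite KE; congr Complex.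
apply: Rintegral_frequencies_odd.
  apply: integrable_bounded_amplitude => //.
  - exact: measurable_frequencies.
  - apply: measurableT_comp.
      by apply: continuous_measurable_fun; exact: continuous_sin.
    by apply: measurable_funB; exact: measurable_wave_phase.
  - by move=> f; rewrite ler_norml sin_geN1 sin_le1.
(* Under [f] to [- f] the amplitude is even, while both phases, hence the sine of their difference,
   are odd. *)
move=> f Of ONf; rewrite /cross_amplitude (eC _ _ f)//.
have [_ _ /(_ f Of ONf) ->] := HS p.1; have [_ _ /(_ f Of ONf) ->] := HS q.1.
rewrite -mulNr -sinN /wave_phase og//; congr (sin _ * _); ring.
Qed.

Lemma real_K_sym {R : realType} {d : nat} (Omega : set R)
    (S : 'cV[R]_d -> R -> R) (u : 'cV[R]_d)
    (C : R -> 'cV[R]_d -> 'cV[R]_d -> R) (g : R -> R) (p q : 'cV[R]_d * R) :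
  (forall f, Omega f -> correlation_function (C f)) ->
  real_K Omega S u C g p q = real_K Omega S u C g q p.
Proof.
move=> HC; apply: eq_Rintegral => f /set_mem /HC[Csym _ _].
by rewrite /cross_amplitude Csym -cosN opprB [S p.1 f * _]mulrC.
Qed.

(** The form is the integral of the fixed-frequency forms, which are nonnegative throughout
    [Omega]. *)
Lemma real_K_psd {R : realType} {d : nat} (Omega : set R)
    (S : 'cV[R]_d -> R -> R) (u : 'cV[R]_d)
    (C : R -> 'cV[R]_d -> 'cV[R]_d -> R) (g : R -> R)
    (n : nat) (p : 'I_n -> 'cV[R]_d * R) (a : 'I_n -> R) :
  measurable Omega ->
  (forall x, spectral_density Omega (S x)) ->
  (forall f, Omega f -> correlation_function (C f)) ->
  (forall x x', measurable_fun Omega (fun f => C f x x')) ->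
  measurable_fun Omega g ->
  0 <= \sum_(j < n) \sum_(k < n) a j * a k * real_K Omega S u C g (p j) (p k).
Proof.
move=> mO HS HC mC mg.
pose h j k f := cos (wave_phase u g (p j) f - wave_phase u g (p k) f) *
  cross_amplitude S C (p j) (p k) f.
have ih j k : (@lebesgue_measure R).-integrable Omega (EFin \o h j k).
  apply: integrable_bounded_amplitude => //.
  - apply: measurableT_comp.
      by apply: continuous_measurable_fun; exact: continuous_cos.
    by apply: measurable_funB; exact: measurable_wave_phase.
  - by move=> f; rewrite ler_norml cos_geN1 cos_le1.
have iah j k : (@lebesgue_measure R).-integrable Omega
    (EFin \o (fun f => a j * a k * h j k f)).
  exact: (@integrableZl _ (measurableTypeR R) R _ Omega mO _ _ (ih j k)).
have -> : \sum_(j < n) \sum_(k < n) a j * a k * real_K Omega S u C g (p j) (p k) =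
    \int[@lebesgue_measure R]_(f in Omega)
      \sum_(j < n) \sum_(k < n) a j * a k * h j k f.
  (* Indexing by pairs lets the sum leave the integral in one step. *)
  under [RHS]eq_Rintegral do rewrite pair_bigA.
  rewrite Rintegral_sum// pair_bigA/=; apply: eq_bigr => -[j k] _ /=.
  by rewrite RintegralZl.
apply: Rintegral_ge0 => f Of; apply: cos_cross_amplitude_psd; last exact: HC.
by move=> x; have [+ _ _] := HS x; apply.
Qed.

(** * Rescaling by [lambda] and adding the nugget *)

Theorem corollary1 (R : realType) (d : nat) (s : sampling R)
    (S : 'cV[R]_d -> R -> R) (u : 'cV[R]_d)
    (C : R -> 'cV[R]_d -> 'cV[R]_d -> R) (g : R -> R)
    (lambda : 'cV[R]_d -> R -> R) (eta : R)
    (S_density : forall x, spectral_density (frequencies s) (S x))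
    (C_corr : forall f, frequencies s f -> correlation_function (C f))
    (C_meas : forall x x', measurable_fun (frequencies s) (fun f => C f x x'))
    (C_even : forall x x', symmetric_on (frequencies s) (fun f => C f x x'))
    (g_meas : measurable_fun (frequencies s) g)
    (g_odd : odd_on (frequencies s) g)
    (lambda_ge0 : forall x t, times s t -> 0 <= lambda x t) :
  covariance_function (spacetime (d := d) s)
    (Ktilde (frequencies s) S u C g lambda eta).
Proof.
pose k := real_K (frequencies s) S u C g.
pose kt p q := lambda p.1 p.2 * lambda q.1 q.2 * k p q + eta ^+ 2 * (p == q)%:R.
(* All three conditions are thereby reduced to the real kernel [kt]. *)
have KtE p q : Ktilde (frequencies s) S u C g lambda eta p q = (kt p q)%:C%C.
  by rewrite /Ktilde K_real// rmorphD !rmorphM rmorph_nat.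
split=> [p q _ _|p q _ _|n p a _].
- by rewrite KtE; apply/complex_realP; exists (kt p q).
- by rewrite !KtE /kt /k real_K_sym// eq_sym [lambda q.1 _ * _]mulrC.
have -> : \sum_(j < n) \sum_(l < n)
    (a j * a l)%:C%C * Ktilde (frequencies s) S u C g lambda eta (p j) (p l) =
    (\sum_(j < n) \sum_(l < n) a j * a l * kt (p j) (p l))%:C%C.
  rewrite rmorph_sum; apply: eq_bigr => j _.
  by rewrite rmorph_sum; apply: eq_bigr => l _; rewrite KtE -rmorphM.
rewrite ler0c.
(* These weights absorb [lambda], leaving a plain quadratic form of [k]. *)
pose b j := a j * lambda (p j).1 (p j).2.
have -> : \sum_(j < n) \sum_(l < n) a j * a l * kt (p j) (p l) =
    \sum_(j < n) \sum_(l < n) b j * b l * k (p j) (p l) +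
    eta ^+ 2 * \sum_(j < n) \sum_(l < n) a j * a l * (p j == p l)%:R.
  rewrite mulr_sumr -big_split; apply: eq_bigr => j _ /=.
  rewrite mulr_sumr -big_split; apply: eq_bigr => l _ /=.
  by rewrite /kt /b; ring.
apply: addr_ge0; last by rewrite mulr_ge0 ?sqr_ge0// sum_eq_ge0.
by apply: real_K_psd => //; exact: measurable_frequencies.
Qed.
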